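(* Let $D=\bigcup_{n\in\mathbb{N}_0}\mathbb{Q}[X^{\frac{1}{2^n}},X^{-\frac{1}{2^n}}]$, $R=\bigcup_{n\in\mathbb{N}_0}\mathbb{Q}[X^{\frac{1}{2^n}}]$, let $S$ be the set of monic polynomials of $R$ with nonzero constant term that are prime elements of $D$, and let $\{k_p\}_{p\in S}$ be a family of nonnegative integers. Then the following statements are equivalent for a nonzero nonunit $f$ of $D$. (1) $f=u_f\prod_{p\in S}p^{k_p}$. (2) $fD=\bigcap_{p\in S}p^{k_p}D$. (3) $f$ is a least common multiple of $\{p^{k_p}\}_{p\in S}$ in $D$.
   Context: $\mathbb{N}_0$ is the set of nonnegative integers, $X$ is an indeterminate over $\mathbb{Q}$, and the elements $X^{1/2^n}$ are compatible roots of $X$, i.e. $(X^{1/2^{n+1}})^2=X^{1/2^n}$. Every prime element of $D$ is associated to exactly one element of $S$. Infinite product: for a nonzero nonunit $f$ of $D$ and nonnegative integers $k_p$ $(p\in S)$, one writes $f=u_f\prod_{p\in S}p^{k_p}$ if (i) for each $p\in S$, $p^{k_p}\mid f$ but $p^{k_p+1}\nmid f$ in $D$; and (ii) whenever $g\in D$ is such that $p^{k_p}\mid g$ but $p^{k_p+1}\nmid g$ for each $p\in S$, then $gD\subseteq fD$. Here $u_f$ is the unit of $D$ such that $f=u_ff_1$ for a monic polynomial $f_1$ of $R$ with $f_1(0)\neq 0$. *)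

(* Defs.v *)
From HB Require Import structures.
From mathcomp Require Import all_boot all_order all_algebra all_field.
From mathcomp Require Import classical_sets.
Set Implicit Arguments.
Unset Strict Implicit.
Unset Printing Implicit Defensive.
Import GRing.Theory.
Local Open Scope classical_set_scope.
Local Open Scope ring_scope.

(* A field K over Q together with compatible roots x n = X^(1/2^n) of an
   element X = x 0 that is transcendental over Q.  The rings R and D below are
   subrings of K; up to isomorphism they do not depend on K and x, and
   dyadic_tower_exists shows that such a K and x exist. *)
Definition dyadic_tower (K : fieldType) (iota : {rmorphism rat -> K})
    (x : nat -> K) : Prop :=
  ~ algebraicOver iota (x 0%N) /\ forall n, x n.+1 ^+ 2 = x n.

Section Rings.
Variables (K : fieldType) (iota : {rmorphism rat -> K}) (x : nat -> K).

Definition eval_root (n : nat) (p : {poly rat}) : K := (map_poly iota p).[x n].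

(* Q[X^(1/2^n)] *)
Definition poly_level (n : nat) : set K := range (eval_root n).

(* Q[X^(1/2^n), X^(-1/2^n)] *)
Definition laurent_level (n : nat) : set K :=
  [set a | exists p m, a = eval_root n p / x n ^+ m].

Definition ringR : set K := \bigcup_n poly_level n.
Definition ringD : set K := \bigcup_n laurent_level n.

(* Being monic and having a nonzero constant term do not depend on the level n
   at which an element of R is written as a polynomial. *)
Definition monicR_nz0 : set K :=
  [set a | exists n (p : {poly rat}),
     [/\ p \is monic, p.[0] != 0 & a = eval_root n p]].

Lemma monicR_nz0_sub : monicR_nz0 `<=` ringR.
Proof. by move=> _ [n [p [_ _ ->]]]; exists n => //; exists p. Qed.

End Rings.

(* Divisibility theory of a subring D of a field K.  The ambient field is only
   used for its operations: cofactors and test elements all range over D. *)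
Section Divisibility.
Variables (K : fieldType) (D : set K).

Definition dvd_in (a b : K) : Prop := exists2 c, D c & b = a * c.

Definition unit_in (a : K) : Prop := D a /\ exists2 b, D b & a * b = 1.

Definition prime_in (p : K) : Prop :=
  [/\ D p, p != 0, ~ unit_in p &
    forall a b, D a -> D b -> dvd_in p (a * b) -> dvd_in p a \/ dvd_in p b].

Definition principal_ideal (a : K) : set K := [set a * c | c in D].

Definition is_lcm (A : set K) (f : K) : Prop :=
  [/\ D f, forall a, A a -> dvd_in a f &
    forall g, D g -> (forall a, A a -> dvd_in a g) -> dvd_in f g].

Definition exact_power (p : K) (m : nat) (g : K) : Prop :=
  dvd_in (p ^+ m) g /\ ~ dvd_in (p ^+ m.+1) g.

End Divisibility.

Section InfiniteProduct.
Variables (K : fieldType) (iota : {rmorphism rat -> K}) (x : nat -> K).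
Local Notation D := (ringD iota x).

Definition primeS : set K := monicR_nz0 iota x `&` [set p | prime_in D p].

Definition unit_part (f u : K) : Prop :=
  unit_in D u /\ exists2 f1, monicR_nz0 iota x f1 & f = u * f1.

(* f = u * prod_(p in S) p ^ (k p), with u = u_f *)
Definition is_infinite_product (f u : K) (k : K -> nat) : Prop :=
  [/\ unit_part f u,
    forall p, primeS p -> exact_power D p (k p) f &
    forall g, D g -> (forall p, primeS p -> exact_power D p (k p) g) ->
      principal_ideal D g `<=` principal_ideal D f].

End InfiniteProduct.

Lemma dyadic_tower_exists :
  exists (K : fieldType) (iota : {rmorphism rat -> K}) (x : nat -> K),
    dyadic_tower iota x.
Proof.
pose F0 : fieldType := {fraction {poly rat}}.
pose to (a : F0) : {poly rat} * {poly rat} := frac (repr a).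
pose from (y : {poly rat} * {poly rat}) : F0 :=
  (\pi_({fraction {poly rat}}) (insubd (ratio0 {poly rat}) y))%qT.
have toK : cancel to from by move=> a; rewrite /from /to valKd reprK.
pose isc : isCountable F0 := CanIsCountable toK.
pose F : countFieldType :=
  HB.pack (GRing.Field.sort F0) (GRing.Field.class F0) isc.
have [C [j _]] := countable_algebraic_closure F.
pose toC (p : {poly rat}) : C := j (tofrac p : F0).
have toCm : zmod_morphism toC by move=> p q; rewrite /toC !rmorphB.
have toCmul : monoid_morphism toC.
  by split=> [|p q]; rewrite /toC ?rmorph1 ?rmorphM.
pose toCa := GRing.isZmodMorphism.Build _ _ toC toCm.
pose toCb := GRing.isMonoidMorphism.Build _ _ toC toCmul.
pose g : {rmorphism {poly rat} -> C} := HB.pack toC toCa toCb.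
pose iota : {rmorphism rat -> C} := g \o polyC.
have sqrt_ex (a : C) : exists b : C, b ^+ 2 == a.
  have [b b2] := @solve_monicpoly C 2 (nth 0 [:: a]) isT.
  exists b; apply/eqP; move: b2.
  by rewrite !big_ord_recl big_ord0 /= mulr1 mul0r !addr0.
pose sq a := xchoose (sqrt_ex a).
exists C, iota, (fun n => iter n sq (g 'X)); split; last first.
  by move=> n /=; apply/eqP; exact: (xchooseP (sqrt_ex _)).
case=> p pn0; have -> : map_poly iota p = map_poly g (p ^:P).
  by rewrite -map_poly_comp.
move=> /rootP; rewrite (horner_map g) => /eqP; rewrite -/(p \Po 'X) comp_polyXr.
by rewrite [_ == _](fmorph_eq0 j) tofrac_eq0 (negPf pn0).
Qed.

(* Main.v *)
(* Any two elements of D lie in a common level, which is a localisation of the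
   principal ideal domain Q[Y]; hence D is a Bezout domain, and an element with
   the exact powers p^(k p) can be replaced in (1) by one merely divisible by
   them: take its gcd with f.  This turns (1) into the lcm property.  Conversely,
   if p^(k p + 1) divided an lcm f, then f / p would still be a common multiple,
   because distinct elements of S do not divide each other: p would be a unit. *)
Require Import Defs.
From mathcomp Require Import all_boot all_order all_algebra.
From mathcomp Require Import boolp classical_sets.
Import GRing.Theory.
Local Open Scope classical_set_scope.
Local Open Scope ring_scope.

(** * Divisibility, primes and least common multiples in a subring of a field *)

Section Subring.
Set Implicit Arguments.
Unset Strict Implicit.
Variables (K : fieldType) (D : set K).
Hypotheses (D1 : D 1) (DM : forall a b, D a -> D b -> D (a * b)).
Implicit Types (a b c p q f g : K) (S : set K).

Lemma subring_exp a n : D a -> D (a ^+ n).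
Proof. by move=> Da; elim: n => // n IHn; rewrite exprS; apply: DM. Qed.

Lemma dvd_in_trans a b c : dvd_in D a b -> dvd_in D b c -> dvd_in D a c.
Proof. by case=> u Du -> [v Dv ->]; exists (u * v); [exact: DM | rewrite mulrA]. Qed.

Lemma principal_ideal_sub a b :
  dvd_in D b a -> principal_ideal D a `<=` principal_ideal D b.
Proof.
by case=> u Du -> _ [v Dv <-]; exists (u * v); [exact: DM | rewrite mulrA].
Qed.

(** Write [p = q * c]. The prime [p] divides [q] or [c], and the latter would make [q] a unit. *)
Lemma prime_in_dvd_sym p q :
  prime_in D p -> prime_in D q -> dvd_in D q p -> dvd_in D p q.
Proof.
case=> Dp p0 _ pP [Dq q0 qU _] [c Dc pE].
have [|//|[d Dd cE]] := pP q c Dq Dc; first by exists 1; rewrite ?mulr1.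
case: qU; split=> //; exists d => //; apply: (mulfI p0).
by rewrite mulr1 {2}pE cE mulrCA.
Qed.

Lemma prime_in_exp_dvd q n p a : prime_in D q -> D p -> D a -> ~ dvd_in D q p ->
  dvd_in D (q ^+ n) (p * a) -> dvd_in D (q ^+ n) a.
Proof.
case=> Dq q0 _ qP Dp Da qNp; elim: n => [|n IHn]; first by exists a; rewrite ?mul1r.
case=> c Dc paE.
(* With [a = q ^+ n * b], cancelling [q ^+ n] in [p * a = q ^+ n.+1 * c] leaves [p * b = q * c], so
   [q] divides [b]. *)
have [|b Db aE] := IHn.
  by exists (q * c); [exact: DM | rewrite paE exprSr mulrA].
have [|//|[d Dd bE]] := qP p b Dp Db.
- exists c => //; apply: (mulfI (expf_neq0 n q0)).
  by rewrite mulrCA -aE paE exprSr mulrA.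
- by exists d; rewrite // aE bE exprSr mulrA.
Qed.

Lemma is_lcm_principal_ideal S (e : K -> K) f :
    (forall p, S p -> D (e p)) -> ~ unit_in D f ->
  is_lcm D [set e p | p in S] f ->
  principal_ideal D f = \bigcap_(p in S) principal_ideal D (e p).
Proof.
move=> De fU [Df fA fmin]; apply/seteqP; split=> [g fg p Sp | g gA].
  by apply: principal_ideal_sub fg; apply: fA; exists p.
(* An empty intersection would be all of [K], not [D]. In that case [1] is a common multiple, so [f]
   would be a unit. *)
have [[p Sp]|S0] := pselect (exists p, S p); last first.
  have [_ [p Sp <-]|c Dc fc] := fmin 1 D1; first by case: S0; exists p.
  by case: fU; split=> //; exists c.
have Dg : D g by have [c Dc <-] := gA p Sp; apply: DM => //; exact: De.
have [_ [q Sq <-]|c Dc ->] := fmin g Dg; last by exists c.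
by have [c Dc <-] := gA q Sq; exists c.
Qed.

Lemma principal_ideal_is_lcm S (e : K -> K) f : D f ->
  principal_ideal D f = \bigcap_(p in S) principal_ideal D (e p) ->
  is_lcm D [set e p | p in S] f.
Proof.
move=> Df fE; split=> // [_ [p Sp <-] | g Dg gA].
  have : principal_ideal D f f by exists 1; rewrite ?mulr1.
  by rewrite fE => /(_ p Sp) [c Dc <-]; exists c.
have : principal_ideal D f g.
  by rewrite fE => p Sp; have [|c Dc ->] := gA (e p); [exists p | exists c].
by case=> c Dc <-; exists c.
Qed.

Lemma exact_min_is_lcm S (k : K -> nat) f :
    (forall a b, D a -> D b -> D (a + b)) ->
    (forall a b, D a -> D b -> exists u v,
       [/\ D u, D v, dvd_in D (u * a + v * b) a & dvd_in D (u * a + v * b) b]) ->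
    D f -> (forall p, S p -> exact_power D p (k p) f) ->
    (forall g, D g -> (forall p, S p -> exact_power D p (k p) g) ->
       principal_ideal D g `<=` principal_ideal D f) ->
  is_lcm D [set p ^+ k p | p in S] f.
Proof.
move=> DD bez Df fS fmin; split=> // [_ [p Sp <-]|g Dg gA].
  by case: (fS p Sp).
have [u [v [Du Dv hf hg]]] := bez f g Df Dg.
set h := u * f + v * g in hf hg.
have Dh : D h by apply: DD; apply: DM.
(* The gcd [h] is an admissible test element: [p ^+ k p] divides both [f] and [g], hence [h], while
   a higher power dividing [h] would divide [f], since [h] divides [f]. *)
have fh : dvd_in D f h.
  have [| |c Dc <-] := fmin h Dh _ h; last by exists c.
    move=> p Sp; have [[c Dc fE] fN] := fS p Sp.
    have [|d Dd gE] := gA (p ^+ k p); first by exists p.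
    split; last by move=> ph; apply: fN; apply: dvd_in_trans ph hf.
    exists (u * c + v * d); first by apply: DD; apply: DM.
    by rewrite /h gE {1}fE mulrDr !(mulrCA (p ^+ _)).
  by exists 1; rewrite ?mulr1.
exact: dvd_in_trans hg.
Qed.

Lemma is_lcm_exact S (k : K -> nat) f p :
    (forall q, S q -> prime_in D q) ->
    (forall q, S q -> dvd_in D q p -> q = p) ->
    f != 0 -> is_lcm D [set q ^+ k q | q in S] f -> S p ->
  exact_power D p (k p) f.
Proof.
move=> Spr Suniq f0 [Df fA fmin] Sp; have [Dp p0 pU _] := Spr p Sp.
split; first by apply: fA; exists p.
case=> c Dc fE; pose f' := p ^+ k p * c.
have Df' : D f' by apply: DM => //; exact: subring_exp.
have fE' : f = p * f' by rewrite fE exprS mulrA.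
have [_ [q Sq <-]|d Dd f'E] := fmin f' Df'.
  (* For [q = p] the power is visible in [f']; any other [q] is prime and does not divide [p], so
     its power in [f = p * f'] already divides [f']. *)
  have [qp|qNp] := pselect (dvd_in D q p); first by rewrite (Suniq q Sq qp); exists c.
  apply: (prime_in_exp_dvd (Spr q Sq) Dp Df' qNp); rewrite -fE'.
  by apply: fA; exists q.
case: pU; split=> //; exists d => //; apply: (mulfI f0).
by rewrite mulr1 {2}fE' f'E mulrCA.
Qed.

End Subring.

(** * The rings [R] and [D] of the dyadic tower *)

Section Tower.
Set Implicit Arguments.
Unset Strict Implicit.
Variables (K : fieldType) (iota : {rmorphism rat -> K}) (x : nat -> K).
Hypothesis tower_x : dyadic_tower iota x.
Local Notation D := (ringD iota x).
Local Notation ev := (eval_root iota x).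
Implicit Types (p q : {poly rat}) (a b : K).

Lemma tower_exp n m : x (n + m) ^+ (2 ^ m) = x n.
Proof.
case: tower_x => _ xS; elim: m => [|m IHm]; first by rewrite addn0 expr1.
by rewrite addnS expnS exprM xS.
Qed.

(** [x 0] is a power of [x n], and powers of algebraic elements are algebraic. *)
Lemma tower_transcendental n : ~ algebraicOver iota (x n).
Proof.
move=> alg; case: tower_x => + _; apply.
rewrite -(tower_exp 0 n); elim: (2 ^ n)%N => [|m IHm].
  by rewrite expr0; exact: algebraic1.
by rewrite exprS; apply: algebraic_mul.
Qed.

Lemma tower_neq0 n : x n != 0.
Proof.
by apply/eqP=> xn0; apply: (@tower_transcendental n); rewrite xn0; exact: algebraic0.
Qed.

Lemma eval_rootD n p q : ev n (p + q) = ev n p + ev n q.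
Proof. by rewrite /eval_root rmorphD hornerD. Qed.

Lemma eval_rootM n p q : ev n (p * q) = ev n p * ev n q.
Proof. by rewrite /eval_root rmorphM hornerM. Qed.

Lemma eval_rootC n c : ev n c%:P = iota c.
Proof. by rewrite /eval_root map_polyC hornerC. Qed.

Lemma eval_rootXn n m : ev n 'X^m = x n ^+ m.
Proof. by rewrite /eval_root map_polyXn hornerXn. Qed.

Lemma eval_root_inj n : injective (ev n).
Proof.
move=> p q pq; apply/eqP; rewrite -subr_eq0; apply/eqP.
apply: contra_notP (@tower_transcendental n) => /eqP pq0; exists (p - q) => //.
by rewrite rootE rmorphB hornerD hornerN /= [X in X - _]pq subrr.
Qed.

(** Since [x n = x m ^+ (2 ^ (m - n))], moving up the tower substitutes a power of the variable. *)
Lemma eval_root_up n m p : (n <= m)%N -> ev n p = ev m (p \Po 'X^(2 ^ (m - n))).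
Proof.
move=> /subnKC nm; rewrite /eval_root map_comp_poly horner_comp map_polyXn hornerXn.
by rewrite -[in x m]nm tower_exp.
Qed.

Lemma ringD_level n p m : D (ev n p / x n ^+ m).
Proof. by exists n => //; exists p, m. Qed.

Lemma ringD_eval n p : D (ev n p).
Proof. by have := ringD_level n p 0; rewrite expr0 divr1. Qed.

Lemma ringD_X n m : D (x n ^+ m).
Proof. by rewrite -eval_rootXn; exact: ringD_eval. Qed.

Lemma laurent_level_up n m : (n <= m)%N ->
  laurent_level iota x n `<=` laurent_level iota x m.
Proof.
move=> nm _ [p [l ->]]; exists (p \Po 'X^(2 ^ (m - n))), (2 ^ (m - n) * l)%N.
by rewrite -eval_root_up // exprM -[in x m](subnKC nm) tower_exp.
Qed.

Lemma ringD_common_level a b : D a -> D b -> exists n p q m,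
  a = ev n p / x n ^+ m /\ b = ev n q / x n ^+ m.
Proof.
move=> [i _ ha] [j _ hb]; pose n := maxn i j.
have [p [m ->]] := laurent_level_up (leq_maxl i j) ha.
have [q [l ->]] := laurent_level_up (leq_maxr i j) hb.
exists n, (p * 'X^l), (q * 'X^m), (m + l)%N.
rewrite !eval_rootM !eval_rootXn exprD !invfM.
have xn0 d : x n ^+ d != 0 by rewrite expf_neq0 ?tower_neq0.
split; first by rewrite mulrACA divff // mulr1.
by rewrite [X in _ = _ * X]mulrC mulrACA divff // mulr1.
Qed.

Lemma ringD1 : D 1.
Proof. by have := ringD_X 0 0; rewrite expr0. Qed.

Lemma ringDD a b : D a -> D b -> D (a + b).
Proof.
move=> Da Db; have [n [p [q [m [-> ->]]]]] := ringD_common_level Da Db.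
by rewrite -mulrDl -eval_rootD; exact: ringD_level.
Qed.

Lemma ringDM a b : D a -> D b -> D (a * b).
Proof.
move=> Da Db; have [n [p [q [m [-> ->]]]]] := ringD_common_level Da Db.
by rewrite mulrACA -eval_rootM -invfM -exprD; exact: ringD_level.
Qed.

Lemma ringD_bezout a b : D a -> D b -> exists u v,
  [/\ D u, D v, dvd_in D (u * a + v * b) a & dvd_in D (u * a + v * b) b].
Proof.
move=> Da Db; have [n [p [q [m [-> ->]]]]] := ringD_common_level Da Db.
have xm0 : x n ^+ m != 0 by rewrite expf_neq0 ?tower_neq0.
have [[u v] /= uvE] := Bezoutp p q; set h := u * p + v * q in uvE.
(* The factor [x n ^+ m] cancels the common denominator, so the combination is [ev n h], with [h] a
   gcd of [p] and [q] over the rationals. *)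
exists (ev n u * x n ^+ m), (ev n v * x n ^+ m).
rewrite -!mulrA !(mulrCA (x n ^+ m)) divff // !mulr1 -!eval_rootM -eval_rootD -/h.
have hdvd r : h %| r -> dvd_in D (ev n h) (ev n r / x n ^+ m).
  move=> /divpK <-; exists (ev n (r %/ h) / x n ^+ m); first exact: ringD_level.
  by rewrite eval_rootM -mulrA mulrCA.
split; try by apply: ringDM; [exact: ringD_eval | exact: ringD_X].
- by apply: hdvd; rewrite (eqp_dvdl _ uvE) dvdp_gcdl.
- by apply: hdvd; rewrite (eqp_dvdl _ uvE) dvdp_gcdr.
Qed.

(** Substituting a positive power of the variable keeps the leading coefficient and the constant
    term. Having every large level available lets several elements share one. *)
Lemma monicR_nz0_up a : monicR_nz0 iota x a -> exists n, forall m, (n <= m)%N ->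
  exists p, [/\ p \is monic, p.[0] != 0 & a = ev m p].
Proof.
case=> n [p [pM p0 ->]]; exists n => m nm.
exists (p \Po 'X^(2 ^ (m - n))); split; last exact: eval_root_up.
  by rewrite monicE lead_coef_comp ?lead_coefXn ?(monicP pM) ?expr1n ?mulr1 //
             size_polyXn ltnS expn_gt0.
by rewrite horner_comp hornerXn expr0n expn_eq0.
Qed.

(* A divisor with nonzero constant term is coprime to the units [x n ^+ m]. *)
Lemma monicR_nz0_dvd a b : monicR_nz0 iota x a -> monicR_nz0 iota x b ->
  dvd_in D a b -> exists n, forall m, (n <= m)%N ->
  exists p q, [/\ p \is monic, q \is monic, a = ev m p, b = ev m q & p %| q].
Proof.
move=> /monicR_nz0_up [i ha] /monicR_nz0_up [j hb] [c [l _ hc] bE].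
exists (maxn (maxn i j) l) => m; rewrite !geq_max => /andP[/andP[im jm] lm].
have [p [pM p0 aE]] := ha m im; have [q [qM _ bE']] := hb m jm.
exists p, q; split=> //; have [r [d cE]] := laurent_level_up lm hc.
have pX : coprimep p 'X^d.
  by rewrite coprimep_expr // -['X]subr0 -[0]/(0%:P) coprimep_XsubC rootE.
rewrite -(Gauss_dvdpl _ pX); apply/dvdpP; exists r.
apply: (@eval_root_inj m); rewrite !eval_rootM eval_rootXn -bE' -aE bE cE.
by rewrite mulrA divfK ?expf_neq0 ?tower_neq0 // mulrC.
Qed.

Lemma monicR_nz0_dvd_eq a b : monicR_nz0 iota x a -> monicR_nz0 iota x b ->
  dvd_in D a b -> dvd_in D b a -> a = b.
Proof.
move=> aR bR /(monicR_nz0_dvd aR bR)[i hi] /(monicR_nz0_dvd bR aR)[j hj].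
have [p [q [pM qM aE bE pq]]] := hi _ (leq_maxl i j).
(* At a common level, injectivity of evaluation identifies the polynomials from the two
   divisibilities; monic polynomials dividing each other are equal. *)
have [q' [p' [_ _ /[!bE]/eval_root_inj<- /[!aE]/eval_root_inj<- qp]]] :=
  hj _ (leq_maxr i j).
by congr (ev _ _); apply/eqP; rewrite -eqp_monic // /eqp pq.
Qed.

(** Splitting the numerator as [q * 'X^d] with [q] nonzero at [0], the unit collects the leading
    coefficient and all powers of [x n]. *)
Lemma unit_part_exists a : D a -> a != 0 -> exists u, unit_part iota x a u.
Proof.
case=> n _ [p [m ->]] pm0; have p0 : p != 0.
  by apply: contraNneq pm0 => ->; rewrite /eval_root rmorph0 horner0 mul0r.
have [d [q]] := multiplicity_XsubC p 0; rewrite p0 subr0 => q0 pE.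
have c0 : lead_coef q != 0.
  by rewrite lead_coef_eq0; apply: contraNneq p0 => qe; rewrite pE qe mul0r.
set c := lead_coef q in c0.
have xn0 e : x n ^+ e != 0 by rewrite expf_neq0 ?tower_neq0.
exists (ev n (c *: 'X^d) / x n ^+ m); split.
  split; first exact: ringD_level.
  exists (ev n (c^-1 *: 'X^m) / x n ^+ d); first exact: ringD_level.
  rewrite mulrACA -invfM -eval_rootM -!mul_polyC mulrACA -polyCM divff // mul1r.
  by rewrite eval_rootM !eval_rootXn [X in _ / X]mulrC divff ?mulf_neq0.
exists (ev n (c^-1 *: q)).
  exists n, (c^-1 *: q); split=> //; first by rewrite monicE lead_coefZ mulVf.
  by rewrite hornerZ mulf_neq0 ?invr_eq0.
rewrite mulrAC -eval_rootM pE -scalerAl -scalerAr scalerA divff // scale1r.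
by rewrite (mulrC q).
Qed.

End Tower.

Theorem corollary5p9 (K : fieldType) (iota : {rmorphism rat -> K})
    (x : nat -> K) (tower_x : dyadic_tower iota x)
    (k : K -> nat) (f : K) :
  ringD iota x f -> f != 0 -> ~ unit_in (ringD iota x) f ->
  [<-> exists u, is_infinite_product iota x f u k;
       principal_ideal (ringD iota x) f =
         \bigcap_(p in primeS iota x) principal_ideal (ringD iota x) (p ^+ k p);
       is_lcm (ringD iota x) [set p ^+ k p | p in primeS iota x] f].
Proof.
move=> Df f0 fU; set D := ringD iota x; set S := primeS iota x.
have D1 : D 1 by exact: ringD1.
have DM a b : D a -> D b -> D (a * b) by exact: ringDM.
tfae=> [[u [_ fS fmin]] | | flcm].
- apply: is_lcm_principal_ideal => //.
    by move=> p [_ [Dp _ _ _]]; exact: subring_exp.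
  by apply: exact_min_is_lcm => //; [exact: ringDD | exact: ringD_bezout].
- exact: principal_ideal_is_lcm.
have [u fu] := unit_part_exists tower_x Df f0; exists u; split=> //.
  move=> p Sp; apply: (is_lcm_exact D1 DM _ _ f0 flcm Sp) => [q [] //|q Sq qp].
  (* Divisibility between primes is mutual, and the normalisation of [S] turns associates into equal
     elements. *)
  case: Sp Sq => [pR pP] [qR qP]; apply: (monicR_nz0_dvd_eq tower_x qR pR qp).
  exact: prime_in_dvd_sym.
(* An element with the exact powers is in particular a common multiple, so the lcm [f] divides
   it. *)
move=> g Dg gS; apply: principal_ideal_sub => //.
by case: flcm => _ _; apply=> // _ [p Sp <-]; have [] := gS p Sp.
Qed.
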